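(* Let $\mathcal{H}$ be a cycle-reset stochastic hybrid system and let $\mathcal{T}_{\mathcal{H}}=(S_{\mathcal{H}},\Sigma_{\mathcal{H}},\kappa_{\mathcal{H}})$ be the stochastic transition system it induces. Then for every $B\in\Sigma_{\mathcal{H}}$, $\mathcal{T}_{\mathcal{H}}$ is decisive with respect to $B$, i.e., for every $\mu\in\mathrm{Dist}(S_{\mathcal{H}})$, $\mathrm{Prob}^{\mathcal{T}_{\mathcal{H}}}_{\mu}(\mathbf{F}\,B\lor\mathbf{F}\,\widetilde{B})=1$.
   Context: Stochastic transition systems. An STS is a tuple $\mathcal{T}=(S,\Sigma,\kappa)$ with $(S,\Sigma)$ a measurable space and $\kappa\colon S\times\Sigma\to[0,1]$ a Markov kernel ($\kappa(s,\cdot)$ is a probability measure for every $s$; $\kappa(\cdot,A)$ is measurable for every $A\in\Sigma$). $\mathrm{Dist}(S)$ is the set of probability distributions on $(S,\Sigma)$. For $\mu\in\mathrm{Dist}(S)$, $\mathrm{Prob}^{\mathcal{T}}_\mu$ is the probability measure on runs (infinite sequences $s_0s_1\ldots$ of states) for which $s_0$ has law $\mu$ and $s_{i+1}$ is drawn from $\kappa(s_i,\cdot)$. $\mathbf{F}\,B$ is the set of runs with $s_i\in B$ for some $i\ge 0$. The avoid-set of $B\in\Sigma$ is $\widetilde{B}=\{s\in S\mid\mathrm{Prob}^{\mathcal{T}}_{\delta_s}(\mathbf{F}\,B)=0\}$ (a measurable set), where $\delta_s$ is the Dirac distribution at $s$. Hybrid systems. A hybrid system (HS) is a tuple $(L,X,\mathcal{A},E,\gamma,\mathcal{I},\mathcal{G},\mathcal{R})$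 where $L$ is a finite set of locations; $X=\{x_1,\ldots,x_n\}$ is a finite set of continuous variables; $\mathcal{A}$ is a finite alphabet of events; $E\subseteq L\times\mathcal{A}\times L$ is a finite set of edges; for each $\ell\in L$, $\gamma_\ell\colon\mathbb{R}^n\times\mathbb{R}^+\to\mathbb{R}^n$ is a continuous function (the dynamics in $\ell$; $\mathbb{R}^+=[0,\infty)$); $\mathcal{I}(\ell)\subseteq\mathbb{R}^n$ is the invariant of $\ell$; $\mathcal{G}(e)\subseteq\mathbb{R}^n$ is the guard of edge $e$; and for each edge $e$ and $v\in\mathbb{R}^n$, $\mathcal{R}_e(v)\subseteq\mathbb{R}^n$ is the reset. States are the elements of $L\times\mathbb{R}^n$. There is a switch-transition $(\ell,v)\xrightarrow{e}(\ell',v')$ for $e=(\ell,a,\ell')\in E$ if $v\in\mathcal{I}(\ell)\cap\mathcal{G}(e)$ and $v'\in\mathcal{R}_e(v)\cap\mathcal{I}(\ell')$; edge $e$ is then said to be enabled at $(\ell,v)$. There is a delay-transition $(\ell,v)\xrightarrow{\tau}(\ell,v')$ for $\tau\in\mathbb{R}^+$ if $\gamma_\ell(v,\tau')\in\mathcal{I}(\ell)$ for all $0\le\tau'\le\tau$ and $v'=\gamma_\ell(v,\tau)$. A mixed transition $\xrightarrow{\tau,e}$ is a delay-transition $\xrightarrow{\tau}$ followed by a switch-transition $\xrightarrow{e}$. For $s=(\ell,v)$, $s+\tau=(\ell,\gamma_\ell(v,\tau))$. $I(s,e)$ is the set of $\tau\in\mathbb{R}^+$ such that $s\xrightarrow{\tau,e}s'$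 for some $s'$, and $I(s)=\bigcup_e I(s,e)$. Standing assumption: all states are non-blocking, i.e., $I(s)\ne\emptyset$ for every state $s$. Stochastic hybrid systems. A stochastic hybrid system (SHS) is a HS (with guards, invariants and resets Borel sets) together with: for each state $s$, a probability distribution $\mu_s$ on $\mathbb{R}^+$ (delays) with $\mu_s(I(s))=1$; for each edge $e$ and $v\in\mathbb{R}^n$, a probability distribution $\eta_e(v)$ on $\mathcal{R}_e(v)$; and for each state $s$ at which some edge is enabled, a probability distribution $p_s$ on $E$ such that $p_s(e)>0$ if and only if $e$ is enabled at $s$. Induced STS. $\mathcal{T}_{\mathcal{H}}=(S_{\mathcal{H}},\Sigma_{\mathcal{H}},\kappa_{\mathcal{H}})$, where $S_{\mathcal{H}}=L\times\mathbb{R}^n$, $\Sigma_{\mathcal{H}}$ is the product of $2^L$ and the Borel $\sigma$-algebra of $\mathbb{R}^n$, and for $s=(\ell,v)$, $B\in\Sigma_{\mathcal{H}}$, $$\kappa_{\mathcal{H}}(s,B)=\int_{\tau\in\mathbb{R}^+}\sum_{e=(\ell,a,\ell')\in E}\Big(p_{s+\tau}(e)\int_{v''\in\mathbb{R}^n}\mathbf{1}_B(\ell',v'')\,d\big(\eta_e(\gamma_\ell(v,\tau))\big)(v'')\Big)d\mu_s(\tau).$$ The data of an SHS are assumed to be such that $\kappa_{\mathcal{H}}$ is a (well-defined) Markov kernel, so that $\mathcal{T}_{\mathcal{H}}$ is an STS. Cycle-reset. An edge $e$ of an SHS is strongly reset if there exist $\mathcal{R}_e^*\subseteq\mathbb{R}^n$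 and $\eta_e^*\in\mathrm{Dist}(\mathcal{R}_e^* )$ such that for all $v\in\mathcal{G}(e)$, $\mathcal{R}_e(v)=\mathcal{R}_e^*$ and $\eta_e(v)=\eta_e^*$. An SHS is cycle-reset if every simple cycle of its discrete graph (vertices $L$, edges $E$) contains a strongly reset edge. *)

(* Defs.v *)
From HB Require Import structures.
From mathcomp Require Import all_boot all_order all_algebra.
From mathcomp Require Import all_classical all_reals all_analysis.
From mathcomp Require Import measurable_realfun.

Set Implicit Arguments.
Unset Strict Implicit.
Unset Printing Implicit Defensive.

Import Order.TTheory GRing.Theory Num.Theory.
Import numFieldNormedType.Exports.

Local Open Scope classical_set_scope.
Local Open Scope ring_scope.

(** * Stochastic transition systems *)

(* A stochastic transition system on the measurable space [S]: a Markov kernel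
   from [S] to itself. *)
Notation sts S R := (R.-pker S ~> S).

Section runs.
Context d (S : measurableType d).

Definition cylinders : set (set (nat -> S)) :=
  \bigcup_i preimage_set_system setT (fun w : nat -> S => w i) measurable.

Definition run := g_sigma_algebraType cylinders.

Definition eventually_in (B : set S) : set run := [set w | exists i, B (w i)].

End runs.

Section run_probability.
Local Open Scope ereal_scope.
Context d (S : measurableType d) (R : realType) (T : sts S R).

(* Probability, from [s], that the next [n] states lie in
   [A 0], ..., [A (n - 1)] respectively. *)
Fixpoint path_prob (n : nat) (A : nat -> set S) (s : S) : \bar R :=
  if n is m.+1 then \int[T s]_(t in A 0%N) path_prob m (fun i => A i.+1) t
  else 1.

Definition is_run_law (mu : probability S R) (P : probability (run S) R) :=
  forall (n : nat) (A : nat -> set S), (forall i, measurable (A i)) ->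
    P [set w : run S | forall i, (i <= n)%N -> A i (w i)] =
    \int[mu]_(s in A 0%N) path_prob n (fun i => A i.+1) s.

(* Such a law exists by the Ionescu-Tulcea theorem, and its values on
   measurable sets are determined since the sets appearing in [is_run_law]
   form a generating pi-system; [get] picks it. *)
Definition run_prob (mu : probability S R) : probability (run S) R :=
  get [set P : probability (run S) R | is_run_law mu P].

Definition avoid_set (B : set S) : set S :=
  [set s | run_prob (dirac s) (eventually_in B) = 0].

Definition decisive (B : set S) :=
  forall mu : probability S R,
    run_prob mu (eventually_in B `|` eventually_in (avoid_set B)) = 1.

End run_probability.

(** * The state space of a hybrid system *)

(* Measurable types are pointed, whence a pointed type of locations; without
   any location there is no state, hence no probability on states. *)
#[short(type="finPointedType")]
HB.structure Definition FinPointed := {T of Finite T & Pointed T}.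

Definition location (L : finPointedType) : Type := L.

Section discrete_location.
Variable L : finPointedType.

HB.instance Definition _ := Pointed.on (location L).
HB.instance Definition _ := @isMeasurable.Build default_measure_display
  (location L) (@discrete_measurable L) (@discrete_measurable0 L)
  (@discrete_measurableC L) (@discrete_measurableU L).

End discrete_location.

Definition Rn (R : realType) (n : nat) : measurableType _ :=
  g_sigma_algebraType (@open 'rV[R]_n).

Definition state (R : realType) (L : finPointedType) (n : nat) :
    measurableType _ :=
  (location L * Rn R n)%type.

(** * Hybrid systems *)

Section edges.
Variables (L A : Type).

Definition edge : Type := (L * A * L)%type.
Definition src (e : edge) : L := e.1.1.
Definition tgt (e : edge) : L := e.2.

End edges.

(* [edges] is the set of edges; [guard] and [reset] are irrelevant off it, and
   so is [flow l v tau] for [tau < 0]. *)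
Record hybrid_system (R : realType) (L : finPointedType) (A : finType)
    (n : nat) := HybridSystem {
  edges : {set L * A * L} ;
  flow : L -> 'rV[R]_n -> R -> 'rV[R]_n ;
  flow_continuous : forall l,
    {within [set x : 'rV[R]_n * R | 0 <= x.2],
      continuous (fun x => flow l x.1 x.2)} ;
  inv_set : L -> set 'rV[R]_n ;
  guard : edge L A -> set 'rV[R]_n ;
  reset : edge L A -> 'rV[R]_n -> set 'rV[R]_n
}.

Section hybrid_system_transitions.
Context (R : realType) (L : finPointedType) (A : finType) (n : nat).
Variable H : hybrid_system R L A n.
Implicit Types (s : state R L n) (e : edge L A) (tau : R).

Definition switch s e s' :=
  [/\ e \in edges H, src e = s.1 /\ tgt e = s'.1,
      (inv_set H s.1 `&` guard H e) s.2 &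
      (reset H e s.2 `&` inv_set H s'.1) s'.2].

Definition enabled s e := exists s', switch s e s'.

Definition after s tau : state R L n := (s.1, flow H s.1 s.2 tau).

Definition delay s tau s' :=
  [/\ 0 <= tau,
      forall tau', 0 <= tau' <= tau -> inv_set H s.1 (flow H s.1 s.2 tau') &
      s' = after s tau].

Definition mixed s tau e s' := exists2 t, delay s tau t & switch t e s'.

Definition edge_delays s e : set R := [set tau | exists s', mixed s tau e s'].

Definition delays s : set R := \bigcup_e edge_delays s e.

Definition nonblocking := forall s, delays s !=set0.

End hybrid_system_transitions.

(** * Stochastic hybrid systems *)

Section kernel_formula.
Local Open Scope ereal_scope.
Context (R : realType) (L : finPointedType) (A : finType) (n : nat).
Variables (H : hybrid_system R L A n)
  (mu : state R L n -> probability R R)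
  (eta : edge L A -> Rn R n -> probability (Rn R n) R)
  (p : state R L n -> edge L A -> R).

Definition kernel_integrand (s : state R L n) (B : set (state R L n))
    (tau : R) : \bar R :=
  \sum_(e in edges H | src e == s.1)
    (p (after H s tau) e)%:E *
    \int[eta e (flow H s.1 s.2 tau)]_v (\1_B ((tgt e, v) : state R L n))%:E.

Definition kernel_formula (s : state R L n) (B : set (state R L n)) : \bar R :=
  \int[mu s]_(tau in [set tau : R | (0 <= tau)%R])
    kernel_integrand s B tau.

End kernel_formula.

(* [switch_prob s] is a distribution on [edges] when some edge is enabled at
   [s]; at the other states, where no distribution is given, it is 0.  The last
   three fields say that the kernel of the induced system is well defined
   (the delays outside [delays hs s] are [delay_law s]-negligible) and
   Markov. *)
Record stochastic_hybrid_system (R : realType) (L : finPointedType)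
    (A : finType) (n : nat) := StochasticHybridSystem {
  hs :> hybrid_system R L A n ;
  hs_nonblocking : nonblocking hs ;
  inv_set_measurable : forall l, measurable (inv_set hs l : set (Rn R n)) ;
  guard_measurable : forall e, e \in edges hs ->
    measurable (guard hs e : set (Rn R n)) ;
  reset_measurable : forall e v, e \in edges hs ->
    measurable (reset hs e v : set (Rn R n)) ;
  delay_law : state R L n -> probability R R ;
  delays_measurable : forall s,
    measurable (delays hs s) ;
  delay_law_delays : forall s, delay_law s (delays hs s) = 1%E ;
  reset_law : edge L A -> Rn R n -> probability (Rn R n) R ;
  reset_law_reset : forall e v, e \in edges hs ->
    reset_law e v (reset hs e v) = 1%E ;
  switch_prob : state R L n -> edge L A -> R ;
  switch_prob_ge0 : forall s e, e \in edges hs -> 0 <= switch_prob s e ;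
  switch_prob_gt0 : forall s e, e \in edges hs ->
    (0 < switch_prob s e <-> enabled hs s e) ;
  switch_prob_sum1 : forall s, (exists e, enabled hs s e) ->
    \sum_(e in edges hs) switch_prob s e = 1 ;
  kernel_integrand_measurable : forall s B, measurable B ->
    measurable_fun (delays hs s)
      (kernel_integrand hs reset_law switch_prob s B) ;
  induced_sts : sts (state R L n) R ;
  induced_stsE : forall s B, measurable B ->
    induced_sts s B = kernel_formula hs delay_law reset_law switch_prob s B
}.

(** * Cycle-reset systems *)

Section cycle_reset.
Context (R : realType) (L : finPointedType) (A : finType) (n : nat).
Variable H : stochastic_hybrid_system R L A n.

Definition strongly_reset (e : edge L A) :=
  exists (Re : set (Rn R n)) (etae : probability (Rn R n) R),
    [/\ measurable Re, etae Re = 1%E &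
      forall v, guard H e v ->
        reset H e v = Re /\
        forall B, measurable B -> reset_law H e v B = etae B].

Definition simple_cycle (c : seq (L * A * L)) : bool :=
  [&& c != [::], all (mem (edges H)) c,
      cycle (fun e f => tgt e == src f) c & uniq (map (@src L A) c)].

Definition cycle_reset :=
  forall c, simple_cycle c -> exists2 e, e \in c & strongly_reset e.

End cycle_reset.

(* Main.v *)
Require Import Defs.
From HB Require Import structures.
From mathcomp Require Import all_boot all_order all_algebra.
From mathcomp Require Import all_classical all_reals all_analysis.
From mathcomp Require Import measurable_realfun.

Set Implicit Arguments.
Unset Strict Implicit.
Unset Printing Implicit Defensive.

Import Order.TTheory GRing.Theory Num.Theory.
Import numFieldNormedType.Exports.

Local Open Scope classical_set_scope.
Local Open Scope ring_scope.

(** Let [g s] be the probability, from [s], of staying forever in the complement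
    [C] of the union of [B] and its avoid-set; it has to be shown that [g = 0].
    The function [g] is harmonic on [C] and vanishes elsewhere.
    If [g] attained a maximum [m > 0], the set [g = m] would be absorbing and
    contained in [C], hence disjoint from [B]: its points would belong to the
    avoid-set, contradicting that they lie in [C].
    In a cycle-reset system a positive supremum is attained: since the edges
    that are not strongly reset form no cycle, [g] is bounded, by induction
    along them, by the maximum of the means of [g] after the finitely many
    strongly reset edges; some mean is thus the supremum of [g], which makes [g]
    almost surely equal to it after that edge.
    The law of the runs exists by the Ionescu-Tulcea theorem, proved for the
    cylinders and then extended by Caratheodory's theorem. *)

(** * The law of the runs *)

Section run_space.
Context d (S : measurableType d).

Definition state_at (i : nat) (w : run S) : S := w i.

Lemma measurable_state_at i : measurable_fun setT (state_at i).
Proof.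
move=> _ A mA; apply: sub_sigma_algebra.
by exists i => //; exists A.
Qed.

Lemma measurable_run d' (X : measurableType d') (f : X -> run S) :
  (forall i, measurable_fun setT (fun x => f x i)) -> measurable_fun setT f.
Proof.
move=> mf.
apply: (measurability (rT := run S) (D := setT) (f := f) (@cylinders _ S) erefl).
move=> _ [_ [i _ [A mA <-]] <-].
by have := mf i measurableT A mA; rewrite !setTI.
Qed.

Lemma measurable_state_at_preimage i (A : set S) : measurable A ->
  measurable (state_at i @^-1` A).
Proof.
by move=> mA; rewrite -[X in measurable X]setTI; exact: measurable_state_at.
Qed.

(** Filling the whole tail with [t] is a convention: only the state at time [k.+1] will matter. *)
Definition extend (k : nat) (w : run S) (t : S) : run S :=
  fun i => if (i <= k)%N then w i else t.

Lemma measurable_extend k :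
  measurable_fun setT (fun x : run S * S => extend k x.1 x.2).
Proof.
apply: measurable_run => i; rewrite /extend; case: (leqP i k) => _.
- exact: (measurableT_comp (measurable_state_at i) (@measurable_fst _ _ (run S) S)).
- exact: (@measurable_snd _ _ (run S) S).
Qed.

Definition agree (k : nat) (w w' : run S) := forall i, (i <= k)%N -> w i = w' i.

Definition depends (k : nat) (X : Type) (f : run S -> X) :=
  forall w w', agree k w w' -> f w = f w'.

Lemma agree_extend k w t : agree k (extend k w t) w.
Proof. by move=> i ik; rewrite /extend ik. Qed.

Lemma depends_le k k' X (f : run S -> X) :
  (k <= k')%N -> depends k f -> depends k' f.
Proof.
by move=> kk' fk w w' ww'; apply: fk => i ik; apply/ww'/(leq_trans ik).
Qed.

Definition cylinder (A : set (run S)) :=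
  measurable A /\ exists k, depends k A.

(** Some index that determines [A], not necessarily the least one; for a set that is no cylinder the
    value is arbitrary. *)
Definition level (A : set (run S)) : nat := get [set k | depends k A].

Lemma levelP A : cylinder A -> depends (level A) A.
Proof. by move=> [_ ex]; apply: (getPex ex). Qed.

Lemma cylinder0 : cylinder set0.
Proof. by split; [exact: measurable0|exists 0%N]. Qed.

Lemma cylinderU : setU_closed cylinder.
Proof.
move=> A B [mA [k Ak]] [mB [l Bl]]; split; first exact: measurableU.
exists (maxn k l) => w w' ww'; rewrite /setU /=.
rewrite (depends_le (leq_maxl k l) Ak ww').
by rewrite (depends_le (leq_maxr k l) Bl ww').
Qed.

Lemma cylinderC : setC_closed cylinder.
Proof.
move=> A [mA [k Ak]]; split; first exact: measurableC.
by exists k => w w' ww'; rewrite /setC /= (Ak _ _ ww').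
Qed.

(** A copy of [run S] whose measurable sets are the algebra of cylinders, from which the measure
    will be extended. *)
Definition cyl_run := run S.

HB.instance Definition _ := Pointed.on cyl_run.
HB.instance Definition _ := isAlgebraOfSets.Build default_measure_display
  cyl_run cylinder0 cylinderU cylinderC.

End run_space.

(** * Conditional probabilities of cylinders and the Ionescu-Tulcea theorem *)

Section ionescu_tulcea.
Local Open Scope ereal_scope.
Context d (S : measurableType d) (R : realType) (T : sts S R).

(** The transition law as a kernel on runs, so that integrals against it are measurable in the
    run. *)
Definition coord_kernel (k : nat) (w : run S) : {measure set S -> \bar R} :=
  T (w k).

Let measurable_coord_kernel k U : measurable U ->
  measurable_fun setT (coord_kernel k ^~ U).
Proof.
move=> mU.
exact: (measurableT_comp (measurable_kernel T U mU) (@measurable_state_at _ S k)).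
Qed.

HB.instance Definition _ k :=
  isKernel.Build _ _ _ _ _ (coord_kernel k) (@measurable_coord_kernel k).

Let coord_kernel_prob k w : coord_kernel k w setT = 1.
Proof. exact: prob_kernel. Qed.

HB.instance Definition _ k :=
  Kernel_isProbability.Build _ _ _ _ _ (coord_kernel k) (coord_kernel_prob k).

Definition step k (f : run S -> \bar R) (w : run S) : \bar R :=
  \int[T (w k)]_t f (extend k w t).

(** The states at times [k.+1], ..., [k + j] are integrated out, the last one innermost. *)
Fixpoint steps k j (f : run S -> \bar R) : run S -> \bar R :=
  if j is j'.+1 then step k (steps k.+1 j' f) else f.

Lemma step_ge0 k f : (forall w, 0 <= f w) -> forall w, 0 <= step k f w.
Proof. by move=> f0 w; apply: integral_ge0. Qed.

Lemma measurable_extendl k w (f : run S -> \bar R) :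
  measurable_fun setT f -> measurable_fun setT (fun t => f (extend k w t)).
Proof.
move=> mf; apply: (measurableT_comp mf).
exact: (measurableT_comp (measurable_extend k) (measurable_pair1 w)).
Qed.

Lemma measurable_step k f : (forall w, 0 <= f w) ->
  measurable_fun setT f -> measurable_fun setT (step k f).
Proof.
move=> f0 mf.
apply: (measurable_fun_integral_finite_kernel
  (fun x : run S * S => f (extend k x.1 x.2)) (coord_kernel k)) => //.
exact: (measurableT_comp mf (measurable_extend k)).
Qed.

Lemma steps_ge0 j k f : (forall w, 0 <= f w) -> forall w, 0 <= steps k j f w.
Proof. by elim: j k => [//|j IH] k f0; apply/step_ge0/IH. Qed.

Lemma measurable_steps j k f : (forall w, 0 <= f w) ->
  measurable_fun setT f -> measurable_fun setT (steps k j f).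
Proof.
elim: j k => [//|j IH] k f0 mf; apply: measurable_step; last exact: IH.
exact: steps_ge0.
Qed.

Lemma depends_step k f : depends k (step k f).
Proof.
move=> w w' ww'; rewrite /step (ww' k)//; apply: eq_integral => t _.
by congr f; apply/funext => i; rewrite /extend; case: ifP => // /ww'.
Qed.

Lemma step_id k f : depends k f -> step k f = f.
Proof.
move=> fk; apply/funext => w; rewrite /step.
under eq_integral => t _ do rewrite (fk _ _ (agree_extend _ _)).
by rewrite integral_cst// prob_kernel mule1.
Qed.

(** The extra innermost step integrates a constant against a probability. *)
Lemma stepsS k j f : depends (k + j) f -> steps k j.+1 f = steps k j f.
Proof.
elim: j k => [|j IH] k fk; first by rewrite /= step_id// -(addn0 k).
by rewrite /= -[in RHS]IH ?addSnnS.
Qed.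

Lemma steps_le k j j' f : (j <= j')%N -> depends (k + j) f ->
  steps k j' f = steps k j f.
Proof.
move=> + fk; elim: j' => [|j' IH]; first by rewrite leqn0 => /eqP ->.
rewrite leq_eqVlt => /predU1P[->//|jj']; rewrite -IH// stepsS//.
by apply: depends_le fk; rewrite leq_add2l.
Qed.

Lemma stepsD k j f g : (forall w, 0 <= f w) -> (forall w, 0 <= g w) ->
  measurable_fun setT f -> measurable_fun setT g ->
  steps k j (f \+ g) = steps k j f \+ steps k j g.
Proof.
move=> f0 g0 mf mg; elim: j k => [//|j IH] k /=; rewrite IH.
apply/funext => w; apply: ge0_integralD => //.
- by move=> t _; exact: steps_ge0.
- by apply: measurable_extendl; exact: measurable_steps.
- by move=> t _; exact: steps_ge0.
- by apply: measurable_extendl; exact: measurable_steps.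
Qed.

Definition eindic (A : set (run S)) (w : run S) : \bar R := (\1_A w)%:E.

(* The conditional probability of [A] given the first states [w 0, ..., w k]. *)
Definition value k (A : set (run S)) : run S -> \bar R :=
  steps k (level A) (eindic A).

Lemma eindic_ge0 A w : 0 <= eindic A w.
Proof. by rewrite lee_fin. Qed.

Lemma measurable_eindic A : measurable A -> measurable_fun setT (eindic A).
Proof. by move=> mA; apply/measurable_EFinP; exact: measurable_indic. Qed.

Lemma depends_eindic k (A : set (run S)) : depends k A -> depends k (eindic A).
Proof.
move=> Ak w w' ww'; have AE := Ak _ _ ww'; rewrite /eindic !indicE.
suff -> : (w \in A) = (w' \in A) by [].
by apply/idP/idP => /set_mem Aw; apply/mem_set; [rewrite -AE|rewrite AE].
Qed.

Lemma value_ge0 k A w : 0 <= value k A w.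
Proof. exact/steps_ge0/eindic_ge0. Qed.

Lemma measurable_value k A : cylinder A -> measurable_fun setT (value k A).
Proof.
move=> [mA _]; apply: measurable_steps; last exact: measurable_eindic.
exact: eindic_ge0.
Qed.

(** Steps beyond the level change nothing, so sets with different levels can be compared after a
    common number of steps. *)
Lemma valueE k j A : cylinder A -> (level A <= k + j)%N ->
  value k A = steps k j (eindic A).
Proof.
move=> cA kj; rewrite /value; have Al := depends_eindic (levelP cA).
have [jl|lj] := leqP j (level A).
  by rewrite (steps_le jl)//; exact: depends_le Al.
by rewrite [RHS](steps_le (ltnW lj))//; apply: depends_le Al; rewrite leq_addl.
Qed.

(** The tower property of conditional probabilities. *)
Lemma valueS k A : cylinder A -> value k A = step k (value k.+1 A).
Proof.
move=> cA; rewrite (@valueE k (level A).+1)//.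
by rewrite addnS (leq_trans (leq_addl k _)).
Qed.

Lemma value_level k A : cylinder A -> (level A <= k)%N -> value k A = eindic A.
Proof. by move=> cA kA; rewrite (@valueE k 0)// addn0. Qed.

Lemma depends_value k A : cylinder A -> depends k (value k A).
Proof. by move=> cA; rewrite valueS//; exact: depends_step. Qed.

Lemma valueU k A B : cylinder A -> cylinder B -> A `&` B = set0 ->
  value k (A `|` B) = value k A \+ value k B.
Proof.
move=> cA cB AB.
(* A number of steps large enough for all three sets, so that [stepsD] applies. *)
pose j := (level A + level B + level (A `|` B))%N.
rewrite !(@valueE k j)//.
- rewrite -stepsD.
  + congr (steps _ _ _); apply/funext => w; rewrite /eindic/= -EFinD.
    congr EFin; rewrite !indicE in_setU.
    have [wA|wA] := boolP (w \in A); have [wB|wB] := boolP (w \in B) => //=;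
      rewrite ?addr0 ?add0r//.
    have : (A `&` B) w := conj (set_mem wA) (set_mem wB).
    by rewrite AB.
  + exact: eindic_ge0.
  + exact: eindic_ge0.
  + by have [+ _] := cA; exact: measurable_eindic.
  + by have [+ _] := cB; exact: measurable_eindic.
- by rewrite (leq_trans (leq_addl k _))// leq_add2l /j -addnA addnCA leq_addr.
- by rewrite (leq_trans (leq_addl k _))// leq_add2l /j -addnA leq_addr.
- exact: cylinderU.
- by rewrite (leq_trans (leq_addl k _))// leq_add2l /j leq_addl.
Qed.

Lemma value_cst k (b : bool) : value k [set _ | b] = cst (b%:R%:E).
Proof.
rewrite /value; elim: (level _) k => [|j IH] k /=.
  by apply/funext => w; rewrite /eindic indicE; case: b; [rewrite mem_set|rewrite memNset].
apply/funext => w; rewrite /step IH integral_cst// prob_kernel mule1//.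
Qed.

Section subadditivity.
Variables (A : set (run S)) (F : nat -> set (run S)).
Hypotheses (cA : cylinder A) (cF : forall n, cylinder (F n)).
Hypothesis AF : A `<=` \bigcup_n F n.

(* Wherever [exceeds] holds, it still holds for a suitable next state.  Choosing
   these states one after the other gives a run in [A] and in no [F n]. *)
Definition exceeds k w := \sum_(n <oo) value k (F n) w < value k A w.

(** If every next state failed, integrating the reverse inequality and exchanging sum and integral
    would give, by [valueS], the reverse inequality at time [k]. *)
Lemma exceeds_extend k w : exceeds k w ->
  exists t, exceeds k.+1 (extend k w t).
Proof.
rewrite /exceeds => kw; apply/not_existsP => H.
move: kw; apply/negP; rewrite -leNgt.
rewrite valueS// (eq_eseriesr (g := fun n => step k (value k.+1 (F n)) w)); last first.
  by move=> n _; rewrite valueS.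
rewrite /step -integral_nneseries//; last first.
- by move=> n t _; exact: value_ge0.
- by move=> n; by apply: measurable_extendl; exact: measurable_value.
apply: ge0_le_integral => //.
- by move=> t _; exact: value_ge0.
- by apply: measurable_extendl; exact: measurable_value.
- apply: ge0_emeasurable_sum => [n t _ _|n _]; first exact: value_ge0.
  by apply: measurable_extendl; exact: measurable_value.
- by move=> t _; rewrite leNgt; apply/negP; exact: H.
Qed.

Lemma value_subadditive w : value 0 A w <= \sum_(n <oo) value 0 (F n) w.
Proof.
rewrite leNgt; apply/negP => e0.
have /choice[next nextP] (kw : nat * run S) : exists t,
    exceeds kw.1 kw.2 -> exceeds kw.1.+1 (extend kw.1 kw.2 t).
  have [e|ne] := pselect (exceeds kw.1 kw.2); last by exists point.
  by have [t ?] := exceeds_extend e; exists t.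
(* The states of [W k] up to time [k] are final; the diagonal [v] collects them. *)
pose W := fix W k := if k is l.+1 then extend l (W l) (next (l, W l)) else w.
have eW k : exceeds k (W k) by elim: k => [//|k IH]; exact: (nextP (k, W k) IH).
pose v : run S := fun i => W i i.
have Wv k : agree k (W k) v.
  elim: k => [|k IH] i; first by rewrite leqn0 => /eqP ->.
  rewrite leq_eqVlt => /predU1P[->//|ik].
  by rewrite -IH//=; exact: agree_extend.
have ev k : exceeds k v.
  have := eW k; rewrite /exceeds (depends_value cA (Wv k)).
  by under eq_eseriesr do rewrite (depends_value (cF _) (Wv k)).
have sum_ge0 k : 0 <= \sum_(n <oo) value k (F n) v.
  by apply: nneseries_ge0 => n _ _; exact: value_ge0.
(* From the level of [A] on, [value] is the indicator of [A]; exceeding a nonnegative sum, it is 1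
   at [v]. *)
have Av : A v.
  have := le_lt_trans (sum_ge0 _) (ev (level A)).
  by rewrite value_level// /eindic lte_fin indicE ltr0n lt0b => /set_mem.
have [n _ Fv] := AF Av.
(* Past both levels, [A] and [F n] both have value 1 at [v], so the sum cannot be smaller than the
   value of [A]. *)
pose k := maxn (level A) (level (F n)).
have := ev k; apply/negP; rewrite -leNgt value_level ?leq_maxl//.
apply: (@le_trans _ _ (value k (F n) v)).
  by rewrite value_level ?leq_maxr// /eindic !indicE !mem_set.
rewrite (nneseriesD1 (n := n))//; last by move=> *; exact: value_ge0.
by rewrite leeDl//; apply: nneseries_ge0 => *; exact: value_ge0.
Qed.

End subadditivity.

(** * Extension to a probability on runs and its values on rectangles *)

Section law.
Variable mu : probability S R.

(** Any run from [s] would do: [value 0 A] depends on the state at time 0 only. *)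
Definition start (s : S) : run S := fun=> s.

Lemma measurable_start : measurable_fun setT start.
Proof. by apply: measurable_run => i; exact: measurable_id. Qed.

Definition premeasure (A : set (cyl_run S)) : \bar R :=
  \int[mu]_s value 0 A (start s).

Let measurable_value_start A : cylinder A ->
  measurable_fun setT (fun s => value 0 A (start s)).
Proof.
move=> cA; exact: (measurableT_comp (measurable_value 0 cA) measurable_start).
Qed.

Lemma premeasure0 : premeasure set0 = 0.
Proof.
rewrite /premeasure (_ : set0 = [set _ | false]); last by apply/seteqP; split=> w.
by rewrite value_cst integral_cst// mul0e.
Qed.

Lemma premeasure_ge0 A : 0 <= premeasure A.
Proof. by apply: integral_ge0 => s _; exact: value_ge0. Qed.

Lemma premeasure_semi_additive : measure_function.semi_additive premeasure.
Proof.
apply/additive2P; first exact: premeasure0.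
move=> A B cA cB AB; rewrite /premeasure valueU//.
by apply: ge0_integralD => //; try (by move=> *; exact: value_ge0);
  exact: measurable_value_start.
Qed.

HB.instance Definition _ := isContent.Build _ _ _ premeasure
  premeasure_ge0 premeasure_semi_additive.

(** Integrating [value_subadditive] gives what a content needs to be a measure on the algebra of
    cylinders. *)
Lemma premeasure_subadditive :
  measurable_subset_sigma_subadditive premeasure.
Proof.
move=> A F cF cA AF; rewrite /premeasure.
rewrite -integral_nneseries//; last first.
- by move=> n s _; exact: value_ge0.
- by move=> n; apply: measurable_value_start; exact: cF.
apply: ge0_le_integral => //.
- by move=> s _; exact: value_ge0.
- by apply: measurable_value_start; exact: cA.
- apply: ge0_emeasurable_sum => [n s _ _|n _]; first exact: value_ge0.
  by apply: measurable_value_start; exact: cF.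
- by move=> s _; exact: value_subadditive.
Qed.

HB.instance Definition _ := Content_SigmaSubAdditive_isMeasure.Build _ _ _
  premeasure premeasure_subadditive.

(** Preimages under coordinates, which generate the sigma-algebra of runs, are cylinders; so the
    Caratheodory extension is a measure on [run S]. *)
Lemma measurable_cyl_run (A : set (run S)) : measurable A ->
  (<<s @measurable _ (cyl_run S) >>) A.
Proof.
apply: smallest_sub; first exact: smallest_sigma_algebra.
move=> _ [i _ [X mX <-]]; apply: sub_sigma_algebra; split.
  exact: measurable_state_at.
by exists i => w w' ww'; rewrite setTI /preimage/= (ww' i).
Qed.

Definition run_law (A : set (run S)) : \bar R := measure_extension premeasure A.

Let run_law0 : run_law set0 = 0.
Proof. exact: measure0. Qed.

Let run_law_ge0 A : 0 <= run_law A.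
Proof. exact: measure_ge0. Qed.

Let run_law_sigma_additive : semi_sigma_additive run_law.
Proof.
move=> F mF tF mUF.
apply: (measure_semi_sigma_additive (s := measure_extension premeasure)) => //.
- by move=> i; exact: measurable_cyl_run.
- exact: measurable_cyl_run.
Qed.

HB.instance Definition _ := isMeasure.Build _ _ _ run_law
  run_law0 run_law_ge0 run_law_sigma_additive.

Lemma run_lawE A : cylinder A -> run_law A = premeasure A.
Proof. by move=> cA; exact: measurable_mu_extE. Qed.

Let run_law_setT : run_law setT = 1.
Proof.
rewrite run_lawE; last by split => //; exists 0%N.
have -> : premeasure setT = \int[mu]_s cst 1 s.
  apply: eq_integral => s _; rewrite -[RHS]/(cst (true%:R%:E) (start s)).
  by rewrite -(value_cst 0 true); congr (value 0 _ _); apply/seteqP; split.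
by rewrite integral_cst// mul1e; exact: probability_setT.
Qed.

HB.instance Definition _ := Measure_isProbability.Build _ _ _ run_law run_law_setT.

Lemma measurable_path_prob n (A : nat -> set S) :
  (forall i, measurable (A i)) ->
  (forall s, 0 <= path_prob T n A s) /\
  measurable_fun setT (path_prob T n A).
Proof.
elim: n A => [|n IH] A mA /=.
  by split=> [s|]; [exact: lee01|exact: measurable_cst].
have [p0 mp] := IH (fun i => A i.+1) (fun i => mA i.+1).
split=> [s|]; first by apply: integral_ge0.
under eq_fun do rewrite integral_mkcond.
apply: measurable_fun_integral_kernel => [U mU||].
- exact: measurable_kernel.
- by apply: erestrict_ge0.
- by apply/(measurable_restrictT _ (mA 0%N)); exact: measurable_funTS.
Qed.

(** Integrating backwards follows the recursion of [path_prob]: the constraints up to time [k] are a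
    constant factor, and the one on the new state [t] restricts the integral to [A k.+1]. *)
Lemma steps_rect n k (A : nat -> set S) (w : run S) :
  (forall i, measurable (A i)) ->
  steps k n (eindic [set w | forall i, (i <= k + n)%N -> A i (w i)]) w =
  eindic [set w | forall i, (i <= k)%N -> A i (w i)] w *
    path_prob T n (fun i => A (k + i.+1)%N) (w k).
Proof.
elim: n k w => [|n IH] k w mA /=; first by rewrite addn0 mule1.
rewrite addnS -addSn /step (eq_integral (fun t =>
  eindic [set w | forall i, (i <= k)%N -> A i (w i)] w *
  ((fun t => path_prob T n (fun i => A (k + i.+2)%N) t) \_ (A k.+1)) t)); last first.
  move=> t _; rewrite IH// {2}/extend ltnn patchE.
  rewrite (_ : (fun i => A (k.+1 + i.+1)%N) = (fun i => A (k + i.+2)%N)); last first.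
    by apply/funext => i; rewrite addSnnS.
  rewrite /eindic !indicE.
  have [wA|wA] := boolP (w \in _); last first.
    rewrite mul0e memNset ?mul0e// => H; move/negP: wA; apply; apply/mem_set => i ik.
    by have := H i (leqW ik); rewrite /extend ik.
  rewrite mul1e; have [tA|tA] := boolP (t \in A k.+1).
    rewrite mem_set ?mul1e// => i; rewrite leq_eqVlt => /predU1P[->|ik].
      by rewrite /extend ltnn; exact: set_mem.
    by rewrite /extend -ltnS ik; apply: (set_mem wA).
  rewrite memNset ?mul0e// => H; move/negP: tA; apply; apply/mem_set.
  by have := H k.+1 (leqnn _); rewrite /extend ltnn.
have [p0 mp] := measurable_path_prob n (fun i => mA (k + i.+2)%N).
rewrite ge0_integralZl//; last 3 first.
- by apply/(measurable_restrictT _ (mA k.+1)); exact: measurable_funTS.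
- by move=> t _; apply: erestrict_ge0.
- exact: eindic_ge0.
by rewrite -integral_mkcond addn1.
Qed.

Lemma depends_rect n (A : nat -> set S) :
  depends n [set w : run S | forall i, (i <= n)%N -> A i (w i)].
Proof.
by move=> w w' ww'; apply/propext; split=> H i ni; [rewrite -ww'//|rewrite ww'//];
  exact: H.
Qed.

Lemma run_law_is_run_law : is_run_law T mu run_law.
Proof.
move=> n A mA; set C := [set w | _].
have cC : cylinder C.
  split; last first.
    by exists n; exact: depends_rect.
  rewrite (_ : C = \bigcap_(i < n.+1) (state_at i @^-1` A i)); last first.
    by apply/seteqP; split=> w H i /=; [move=> ni; apply: H|move=> ni; apply: H].
  by apply: bigcap_measurableType => i _; exact: measurable_state_at_preimage.
apply: (eq_trans (run_lawE cC)); rewrite /premeasure [RHS]integral_mkcond.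
apply: eq_integral => s _.
(* The chosen [level C] need not be [n]: the number of steps is raised to the maximum, then lowered
   to [n]. *)
rewrite (@valueE 0 (maxn n (level C)))// ?leq_maxr//.
rewrite (@steps_le 0 n)// ?leq_maxl//; last first.
  by apply: depends_eindic; exact: depends_rect.
rewrite steps_rect// patchE /eindic indicE.
have [sA|sA] := boolP (s \in A 0%N).
  by rewrite mem_set ?mul1e// => i; rewrite leqn0 => /eqP ->; exact: set_mem.
by rewrite memNset ?mul0e// => /(_ 0%N (leqnn _)) /mem_set; exact/negP.
Qed.

End law.

(** The law just constructed guarantees that [get] in [run_prob] picks a genuine run law. *)
Lemma run_probP (mu : probability S R) : is_run_law T mu (run_prob T mu).
Proof.
have ex : exists P : probability (run S) R, is_run_law T mu P.
  by exists (run_law mu); exact: run_law_is_run_law.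
exact: (getPex ex).
Qed.

End ionescu_tulcea.

(** * Decisiveness and the maxima of the survival probability *)

Section unit_mass.
Local Open Scope ereal_scope.
Context d (X : measurableType d) (R : realType).
Variables (nu : {measure set X -> \bar R}) (nu1 : nu setT = 1).

Lemma integral_le_cst (f : X -> \bar R) (c : \bar R) :
  (forall x, 0 <= f x) -> measurable_fun setT f ->
  (forall x, f x <= c) -> \int[nu]_x f x <= c.
Proof.
move=> f0 mf fc; rewrite -[leRHS]mule1 -nu1 -integral_cst//.
exact: ge0_le_integral.
Qed.

(** The deficit [m - f] is nonnegative with integral 0, hence vanishes almost everywhere. *)
Lemma integral_eq_max (f : X -> \bar R) (m : \bar R) : m \is a fin_num ->
  (forall x, 0 <= f x) -> measurable_fun setT f -> (forall x, f x <= m) ->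
  \int[nu]_x f x = m -> nu [set x | f x = m] = 1.
Proof.
move=> mfin f0 mf fm fE; pose h x := m - f x.
have h0 x : 0 <= h x by rewrite sube_ge0 ?fm// mfin orbT.
have ffin x : f x \is a fin_num.
  by rewrite ge0_fin_numE// (le_lt_trans (fm x))// -ge0_fin_numE// (le_trans (f0 x)).
have mh : measurable_fun setT h by apply: emeasurable_funB => //; exact: measurable_cst.
have h_int : \int[nu]_x h x = 0.
  have : \int[nu]_x (h x + f x) = m.
    under eq_integral do rewrite /h subeK//.
    by rewrite integral_cst// nu1 mule1.
  rewrite ge0_integralD// fE => /(congr1 (fun x => x - m)).
  by rewrite addeK// subee.
have h_abs : \int[nu]_x `|h x| = 0.
  by under eq_integral do rewrite gee0_abs//.
have mK : measurable [set x | f x = m].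
  by rewrite -[X in measurable X]setTI; exact: (mf measurableT _ (emeasurable_set1 m)).
have [N [mN N0 hN]] := (ae_eq_integral_abs nu measurableT mh).1 h_abs.
have K0 : nu (~` [set x | f x = m]) = 0.
  apply: (subset_measure0 _ mN _ N0); first exact: measurableC.
  move=> x /= fxm; apply: hN => /= /(_ Logic.I) hx0; apply: fxm.
  by rewrite -[RHS](@subeK _ m (f x))// -/(h x) hx0 add0e.
pose K := [set x | f x = m].
have : nu (~` K `|` K) = nu (~` K) + nu K.
  by apply: measureU (setICl _) => //; exact: measurableC.
by rewrite setvU nu1 K0 add0e => <-.
Qed.

End unit_mass.

(** * The probability of staying in a set forever *)

Section survival.
Local Open Scope ereal_scope.
Context d (S : measurableType d) (R : realType) (T : sts S R).
Variables (D : set S) (mD : measurable D).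

(** [path_prob] does not constrain the present state; the indicator does, so times 0 to [n] are
    covered. *)
Definition stay (n : nat) (s : S) : \bar R :=
  (\1_D s)%:E * path_prob T n (fun=> D) s.

Lemma stay0 s : stay 0 s = (\1_D s)%:E.
Proof. by rewrite /stay mule1. Qed.

Lemma stayE n s : stay n s = (path_prob T n (fun=> D) \_ D) s.
Proof. by rewrite /stay patchE indicE; case: ifP; rewrite ?mul1e ?mul0e. Qed.

Lemma staySE n s : stay n.+1 s = (\1_D s)%:E * \int[T s]_t stay n t.
Proof.
rewrite /stay/= integral_mkcond; congr (_ * _).
by apply: eq_integral => t _; rewrite -stayE.
Qed.

Lemma stay_ge0 n s : 0 <= stay n s.
Proof.
by apply: mule_ge0; [rewrite lee_fin|have [] := measurable_path_prob T n (fun=> mD)].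
Qed.

Lemma measurable_stay n : measurable_fun setT (stay n).
Proof.
have [_ mp] := measurable_path_prob T n (fun=> mD).
by apply: emeasurable_funM => //; apply/measurable_EFinP; exact: measurable_indic.
Qed.

Lemma stay_le1 n s : stay n s <= 1.
Proof.
elim: n s => [|n IH] s; first by rewrite stay0 lee_fin indicE lern1 leq_b1.
rewrite staySE -[leRHS]mule1; apply: lee_pmul.
- by rewrite lee_fin.
- by apply: integral_ge0 => t _; exact: stay_ge0.
- by rewrite lee_fin indicE lern1 leq_b1.
- apply: integral_le_cst => //; first exact: prob_kernel.
  + exact: stay_ge0.
  + exact: measurable_stay.
Qed.

Lemma stayS_le n s : stay n.+1 s <= stay n s.
Proof.
elim: n s => [|n IH] s.
  rewrite staySE stay0 -[leRHS]mule1; apply: lee_wpmul2l; first by rewrite lee_fin.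
  apply: integral_le_cst; [exact: prob_kernel|exact: stay_ge0|exact: measurable_stay|].
  exact: stay_le1.
rewrite !staySE; apply: lee_wpmul2l; first by rewrite lee_fin.
by apply: ge0_le_integral => // [t _||]; [exact: stay_ge0|exact: measurable_stay..].
Qed.

Lemma stay_nonincreasing s : nonincreasing_seq (stay ^~ s).
Proof. by apply/nonincreasing_seqP => n; exact: stayS_le. Qed.

(** The probability of never leaving [D], by [run_prob_surv]; as a limit of [stay] it is visibly
    measurable. *)
Definition surv (s : S) : \bar R := limn (stay ^~ s).

Lemma stay_cvg s : stay ^~ s @ \oo --> surv s.
Proof. exact/ereal_nonincreasing_is_cvgn/stay_nonincreasing. Qed.

Lemma surv_ge0 s : 0 <= surv s.
Proof.
by apply: lime_ge; [exact: stay_cvg|apply: nearW => n; exact: stay_ge0].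
Qed.

Lemma surv_le1 s : surv s <= 1.
Proof.
by apply: lime_le; [exact: stay_cvg|apply: nearW => n; exact: stay_le1].
Qed.

Lemma measurable_surv : measurable_fun setT surv.
Proof.
by apply: (emeasurable_fun_cvg stay) => [n|s _]; [exact: measurable_stay|exact: stay_cvg].
Qed.

Lemma integral_stay_cvg (nu : {measure set S -> \bar R}) : nu setT = 1 ->
  \int[nu]_s stay n s @[n --> \oo] --> \int[nu]_s surv s.
Proof.
move=> nu1.
have [] // := @dominated_convergence _ _ _ nu setT measurableT stay surv (cst 1).
- exact: measurable_stay.
- exact: measurable_surv.
- by apply: aeW => s _; exact: stay_cvg.
- apply/integrableP; split; first exact: measurable_cst.
  rewrite (eq_integral (cst 1)) => [|x _]; last by rewrite gee0_abs.
  by rewrite integral_cst// nu1 mule1 ltry.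
- by apply: aeW => s n _; rewrite gee0_abs ?stay_ge0// stay_le1.
Qed.

(** Harmonicity on [D]: the first-step equation [staySE] passes to the limit by dominated
    convergence. *)
Lemma survE s : surv s = (\1_D s)%:E * \int[T s]_t surv t.
Proof.
apply: cvg_lim => //; rewrite -(cvg_shiftS (stay ^~ s)).
under eq_fun do rewrite staySE.
by apply: cvgeZl => //; apply: integral_stay_cvg; exact: prob_kernel.
Qed.

Lemma run_prob_stay (mu : probability S R) n :
  run_prob T mu [set w : run S | forall i, (i <= n)%N -> D (w i)] =
  \int[mu]_s stay n s.
Proof.
rewrite (run_probP T mu n (fun=> mD)) integral_mkcond.
by apply: eq_integral => s _; rewrite -stayE.
Qed.

Lemma run_prob_surv (mu : probability S R) :
  run_prob T mu [set w : run S | forall i, D (w i)] = \int[mu]_s surv s.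
Proof.
pose F n := [set w : run S | forall i, (i <= n)%N -> D (w i)].
have mF n : measurable (F n).
  rewrite (_ : F n = \bigcap_(i < n.+1) (state_at i @^-1` D)).
    by apply: bigcap_measurableType => i _; exact: measurable_state_at_preimage.
  by apply/seteqP; split=> w H i /= ni; apply: H.
have -> : [set w : run S | forall i, D (w i)] = \bigcap_n F n.
  by apply/seteqP; split=> [w H n _ i _|w H i]; [exact: H|exact: (H i Logic.I i)].
have FP : run_prob T mu (F n) @[n --> \oo] --> run_prob T mu (\bigcap_n F n).
  apply: nonincreasing_cvg_mu => //.
  - by rewrite -ge0_fin_numE// fin_num_measure.
  - exact: bigcap_measurableType.
  - by move=> m n mn; apply/subsetPset => w H i im; apply: H; exact: leq_trans mn.
have FE : (fun n => run_prob T mu (F n)) = (fun n => \int[mu]_s stay n s).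
  by apply/funext => n; exact: run_prob_stay.
rewrite FE in FP; apply: cvg_unique FP _ => //.
by apply: integral_stay_cvg; exact: probability_setT.
Qed.

End survival.

(** * The avoid-set and decisiveness in terms of survival probabilities *)

Section avoidance.
Local Open Scope ereal_scope.
Context d (S : measurableType d) (R : realType) (T : sts S R).
Variables (B : set S) (mB : measurable B).

Lemma measurable_always (D : set S) : measurable D ->
  measurable [set w : run S | forall i, D (w i)].
Proof.
move=> mD; rewrite (_ : [set _ | _] = \bigcap_i (state_at i @^-1` D)).
  by apply: bigcap_measurableType => i _; exact: measurable_state_at_preimage.
by apply/seteqP; split=> [w H i _|w H i]; [exact: H|exact: (H i Logic.I)].
Qed.

Lemma run_prob_eventually (D : set S) (mu : probability S R) : measurable D ->
  run_prob T mu (eventually_in D) = 1 - \int[mu]_s surv T (~` D) s.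
Proof.
move=> mD; rewrite -run_prob_surv; last exact: measurableC.
rewrite -probability_setC; last by apply: measurable_always; exact: measurableC.
congr (run_prob T mu _); apply/seteqP; split=> w.
  by move=> [i Di] H; exact: (H i).
by move=> /existsNP[i /contrapT Di]; exists i.
Qed.

(** Reaching [B] and staying outside it are complementary; this also makes the avoid-set measurable,
    as a level set of [surv]. *)
Lemma avoid_setE : avoid_set T B = [set s | surv T (~` B) s = 1].
Proof.
have mB' := measurableC mB.
apply/seteqP; split=> s; rewrite /avoid_set /= run_prob_eventually//.
all: rewrite integral_dirac//; last exact: measurable_surv.
all: rewrite diracT mul1e.
- have := surv_ge0 T mB' s; have := surv_le1 T mB' s.
  move: (surv T _ s) => [r| |]//= _ _ /eqP.
  by rewrite -EFinB eqe subr_eq0 => /eqP <-.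
- by move=> ->; rewrite subee.
Qed.

Lemma measurable_avoid_set : measurable (avoid_set T B).
Proof.
rewrite avoid_setE -[X in measurable X]setTI.
have mS := measurable_surv T (measurableC mB).
exact: (mS measurableT _ (emeasurable_set1 (1 : \bar R))).
Qed.

Definition limbo : set S := ~` (B `|` avoid_set T B).

Lemma measurable_limbo : measurable limbo.
Proof.
by apply: measurableC; apply: measurableU => //; exact: measurable_avoid_set.
Qed.

(* The set where the survival probability attains its maximum [m] is absorbing
   and disjoint from [B], hence included in the avoid-set. *)
Lemma surv_limbo_lt (m : \bar R) : 0 < m ->
  (forall s, surv T limbo s <= m) -> forall s, surv T limbo s < m.
Proof.
move=> m0 gm s; rewrite lt_neqAle gm andbT; apply/eqP => gs.
have mL := measurable_limbo; have mB' := measurableC mB.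
pose K := [set t | surv T limbo t = m].
have mfin : m \is a fin_num.
  by rewrite -gs ge0_fin_numE ?surv_ge0// (le_lt_trans (surv_le1 _ _ _))// ltry.
have mK : measurable K.
  rewrite -[X in measurable X]setTI; have mS := measurable_surv T mL.
  exact: (mS measurableT _ (emeasurable_set1 m)).
(* Harmonicity: off [limbo] the value would be 0, and on it a mean equal to the maximum forces the
   next state into [K] almost surely. *)
have KL t : K t -> limbo t /\ T t K = 1.
  rewrite /K /= survE// indicE; have [tL|] := boolP (t \in limbo); last first.
    by rewrite mul0e => _ m_eq0; rewrite -m_eq0 ltxx in m0.
  rewrite mul1e => gt; split; first exact: set_mem.
  apply: integral_eq_max => //; first exact: prob_kernel.
  - exact: surv_ge0.
  - exact: measurable_surv.
have stayK n t : K t -> stay T (~` B) n t = 1.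
  elim: n t => [|n IH] t Kt; have [Lt TK] := KL t Kt;
    have Bt : t \in ~` B by apply/mem_set => Bt; apply: Lt; left.
    by rewrite stay0 indicE Bt.
  rewrite staySE indicE Bt mul1e; apply/eqP; rewrite eq_le; apply/andP; split.
    apply: integral_le_cst; [exact: prob_kernel|exact: stay_ge0|exact: measurable_stay|].
    exact: stay_le1.
  (* By induction [stay] is 1 on [K], so its mean is at least [T t K], which is 1. *)
  rewrite -TK -[X in T t X]setIT -integral_indic//.
  apply: ge0_le_integral => //.
  - by apply/measurable_EFinP; exact: measurable_indic.
  - exact: measurable_stay.
  - move=> u _; rewrite indicE; have [/set_mem uK|_] := boolP (u \in K).
      by rewrite IH.
    exact: stay_ge0.
have [Ls _] := KL s gs; apply: Ls; right; rewrite avoid_setE /=.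
by apply: cvg_lim => //; under eq_fun do rewrite stayK//; exact: cvg_cst.
Qed.

Lemma decisive_surv : (forall s, surv T limbo s = 0) -> decisive T B.
Proof.
move=> g0 mu.
rewrite (_ : _ `|` _ = eventually_in (B `|` avoid_set T B)); last first.
  apply/seteqP; split=> w; first by move=> [] [i]; exists i; [left|right].
  by move=> [i [|]]; [left|right]; exists i.
rewrite run_prob_eventually; last first.
  by apply: measurableU => //; exact: measurable_avoid_set.
by rewrite -/limbo integral0_eq ?sube0.
Qed.

End avoidance.

(** * Cycle-reset hybrid systems *)

Section conull.
Local Open Scope ereal_scope.
Context d (X : measurableType d) (R : realType).
Import HBNNSimple.

(* [f] may fail to be measurable off [D], so [ge0_negligible_integral] does not
   apply to it; it does apply to the simple functions below [f]. *)
Lemma integral_le_conull (nu : probability X R) (A D : set X)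
    (f : X -> \bar R) : measurable D -> D `<=` A -> nu D = 1 ->
  (forall x, A x -> 0 <= f x) -> measurable_fun D f ->
  \int[nu]_(x in A) f x <= \int[nu]_(x in D) f x.
Proof.
move=> mD DA nuD f0 mf; rewrite ge0_integralE//.
apply: ge_ereal_sup => _ /= [h hf <-].
rewrite -integralT_nnsfun (@ge0_negligible_integral _ _ _ _ _ (~` D))//.
- rewrite setTD setCK; apply: ge0_le_integral => //.
  + by move=> x _; rewrite lee_fin.
  + by apply/measurable_EFinP; exact: measurable_funTS.
  + by move=> x Dx; rewrite (le_trans (hf x))// patchE mem_set//; exact: DA.
- exact: measurableC.
- by apply/measurable_EFinP.
- by move=> x _; rewrite lee_fin.
- by apply: (eq_trans (probability_setC nu mD)); rewrite [X in _ - X]nuD subee.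
Qed.

End conull.

(** * Cycles of a self-map of a finite set *)

Section cycles.
Variable T : finType.

Lemma cycle_in_closed (F : T -> T) (P : pred T) x : P x ->
  (forall y, P y -> P (F y)) ->
  exists c, [/\ c != [::], fcycle F c, uniq c & all P c].
Proof.
move=> Px PF.
(* The orbit of [x] first closes up by returning to index [i]; its part from [i] on is the cycle. *)
have /trajectP[i ik Ei] := looping_order F x.
exists (traject F (iter i F x) (order F x - i)).
have Pt m y : P y -> all P (traject F y m).
  by elim: m y => //= m IH y Py; rewrite Py IH ?PF.
have n0 : (0 < order F x - i)%N by rewrite subn_gt0.
split.
- by case: (order F x - i)%N n0.
- have : iter (order F x - i) F (iter i F x) = iter i F x.
    by rewrite -iterD subnK ?Ei// ltnW.
  case: (order F x - i)%N n0 => // m _ En /=.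
  by rewrite -[X in rcons _ X]En iterSr -trajectSr; exact: fpath_traject.
- have := orbit_uniq F x; rewrite /orbit -{1}[order F x](subnKC (ltnW ik)).
  by rewrite trajectD cat_uniq => /and3P[].
- by apply: Pt; elim: i {ik Ei n0} => //= i; exact: PF.
Qed.

End cycles.

(** * One-step bounds and the maximum principle for hybrid systems *)

Section hybrid.
Local Open Scope ereal_scope.
Context (R : realType) (L : finPointedType) (A : finType) (n : nat).
Variable H : stochastic_hybrid_system R L A n.
Import HBNNSimple.

Let St := state R L n.
Let T := induced_sts H.

(** Choosing such an edge at each location of [P] gives a self-map preserving [P]; its cycle yields
    a simple cycle without strongly reset edge. *)
Lemma cycle_reset_acyclic (HH : cycle_reset H) (P : pred L) l : P l ->
  (forall l, P l -> exists e, [/\ e \in edges H, src e = l,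
    ~ strongly_reset H e & P (tgt e)]) -> False.
Proof.
move=> Pl PE.
have /choice[E EP] (k : L) : exists e, P k -> [/\ e \in edges H, src e = k,
    ~ strongly_reset H e & P (tgt e)].
  case: (boolP (P k)) => [/PE[e ?]|_]; first by exists e.
  by have [e _] := PE l Pl; exists e.
have [c [c0 cc cu /allP cP]] := cycle_in_closed (F := fun k => tgt (E k)) Pl
  (fun k Pk => let: And4 _ _ _ Pt := EP k Pk in Pt).
have [|_ /mapP[k kc ->]] := HH (map E c).
  apply/and4P; split.
  - by case: c c0 {cc cu cP}.
  - by apply/allP => _ /mapP[k kc ->]; have [] := EP k (cP k kc).
  - apply: (homo_cycle_in (P := P) _ _ cc); last exact/allP.
    by move=> k k' Pk Pk' /= /eqP kk'; have [_ -> _ _] := EP k' Pk'; rewrite kk'.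
  - rewrite -map_comp map_id_in// => k kc /=; by have [] := EP k (cP k kc).
by have [] := EP k (cP k kc).
Qed.

Lemma delays_enabled (s : St) tau : delays H s tau ->
  (0 <= tau)%R /\ exists e, enabled H (after H s tau) e.
Proof.
move=> [e _ [s' [t [tau0 _ ->] sw]]]; split=> //.
by exists e, s'.
Qed.

Lemma kernel_integrand_ge0 (s : St) (B : set St) tau :
  0 <= kernel_integrand H (reset_law H) (switch_prob H) s B tau.
Proof.
apply: sume_ge0 => e /andP[eH _]; apply: mule_ge0.
  by rewrite lee_fin switch_prob_ge0.
by apply: integral_ge0 => v _; rewrite lee_fin.
Qed.

(** [kernel_formula] integrates over all [tau >= 0]; this passes to the delays, where the integrand
    is known to be measurable. An upper bound suffices below. *)
Lemma induced_sts_le (s : St) (B : set St) : measurable B ->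
  T s B <= \int[delay_law H s]_(tau in delays H s)
    kernel_integrand H (reset_law H) (switch_prob H) s B tau.
Proof.
move=> mB; rewrite /T induced_stsE//; apply: integral_le_conull.
- exact: delays_measurable.
- by move=> tau /delays_enabled[].
- exact: delay_law_delays.
- by move=> tau _; exact: kernel_integrand_ge0.
- exact: kernel_integrand_measurable.
Qed.

Lemma measurable_slice d' (Y : measurableType d') (g : St -> Y) (l : L) :
  measurable_fun setT g ->
  measurable_fun setT (fun v : Rn R n => g (l, v)).
Proof.
move=> mg.
exact: (measurableT_comp mg (@measurable_pair1 _ _ (location L) (Rn R n) l)).
Qed.

(* Only the sum over the edges is known to be measurable in [tau], not its
   terms: the integral over the delays is never split along the edges. *)
Lemma kernel_integrand_nnsfun (h : {nnsfun St >-> R}) (s : St) tau :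
  \sum_(x \in range h) x%:E *
    kernel_integrand H (reset_law H) (switch_prob H) s (h @^-1` [set x]) tau =
  \sum_(e in edges H | src e == s.1) (switch_prob H (after H s tau) e)%:E *
    \int[reset_law H e (flow H s.1 s.2 tau)]_v (h ((tgt e, v) : St))%:E.
Proof.
rewrite fsbig_finite//=.
under eq_bigr => x _.
  rewrite /kernel_integrand ge0_sume_distrr; last first.
    move=> e /andP[eH _]; apply: mule_ge0; first by rewrite lee_fin switch_prob_ge0.
    by apply: integral_ge0 => v _; rewrite lee_fin.
  over.
rewrite exchange_big/=; apply: eq_bigr => e _.
pose hx (x : R) (v : Rn R n) : \bar R :=
  (x * \1_(h @^-1` [set x]) ((tgt e, v) : St))%:E.
have mhx x : measurable_fun setT (hx x).
  apply/measurable_EFinP; apply: measurable_funM => //.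
  apply: (@measurable_slice _ (measurableTypeR R) (\1_(h @^-1` [set x]) : St -> R)).
  exact: measurable_indic.
have hx0 x v : 0 <= hx x v by exact: nnfun_muleindic_ge0.
pose P := reset_law H e (flow H s.1 s.2 tau).
(* For negative [x] the level set of [h] is empty, so the scalar can still be moved inside. *)
have hxE x : x%:E * \int[P]_v (\1_(h @^-1` [set x]) ((tgt e, v) : St))%:E =
    \int[P]_v hx x v.
  rewrite (integralZl_indic _ (fun x => (fun v => h (tgt e, v)) @^-1` [set x]))//.
  - by move=> x0; rewrite -subset0 => v /= hv; move: x0; rewrite -hv ltNge fun_ge0.
  - rewrite -[X in measurable X]setTI.
    exact: (measurable_slice (tgt e) (g := h)).
under eq_bigr do rewrite muleCA hxE.
rewrite -ge0_sume_distrr; last by move=> x _; exact: integral_ge0.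
congr (_ * _); rewrite -ge0_integral_sum//.
apply: eq_integral => v _; rewrite fimfunE fsbig_finite//= -sumEFin.
by apply: eq_bigr.
Qed.

(** Edges that are not enabled have weight 0, and the weights of the edges leaving [s.1] total at
    most 1. *)
Lemma kernel_integrand_nnsfun_le (h : {nnsfun St >-> R}) (s : St) tau (c : R) :
  delays H s tau -> (0 <= c)%R ->
  (forall e, e \in edges H -> src e = s.1 -> enabled H (after H s tau) e ->
    \int[reset_law H e (flow H s.1 s.2 tau)]_v (h ((tgt e, v) : St))%:E <= c%:E) ->
  \sum_(x \in range h) x%:E *
    kernel_integrand H (reset_law H) (switch_prob H) s (h @^-1` [set x]) tau
  <= c%:E.
Proof.
move=> /delays_enabled[_ ex] c0 hc; rewrite kernel_integrand_nnsfun.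
apply: (@le_trans _ _ (\sum_(e in edges H | src e == s.1)
    (switch_prob H (after H s tau) e * c)%:E)).
  apply: lee_sum => e /andP[eH /eqP es].
  have := switch_prob_ge0 (after H s tau) eH.
  rewrite le_eqVlt => /predU1P[<-|p0]; first by rewrite mul0e mul0r.
  rewrite EFinM; apply: lee_wpmul2l; first by rewrite lee_fin ltW.
  by apply: hc => //; apply/switch_prob_gt0.
rewrite sumEFin lee_fin -mulr_suml ler_piMl//.
rewrite -(switch_prob_sum1 ex) big_mkcondr/=; apply: ler_sum => e eH.
by case: ifP => // _; exact: switch_prob_ge0.
Qed.

Lemma integral_induced_sts_le (s : St) (g : St -> \bar R) (c : R) :
  (forall t, 0 <= g t) -> measurable_fun setT g -> (0 <= c)%R ->
  (forall tau e, e \in edges H -> src e = s.1 -> enabled H (after H s tau) e ->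
    \int[reset_law H e (flow H s.1 s.2 tau)]_v g ((tgt e, v) : St) <= c%:E) ->
  \int[T s]_t g t <= c%:E.
Proof.
move=> g0 mg c0 gc; rewrite ge0_integralTE//.
apply: ge_ereal_sup => _ /= [h hg <-]; rewrite sintegralE.
pose KI x := kernel_integrand H (reset_law H) (switch_prob H) s (h @^-1` [set x]).
have mKI x : measurable_fun (delays H s) (KI x) by exact: kernel_integrand_measurable.
have KI0 x tau : 0 <= KI x tau by exact: kernel_integrand_ge0.
have xKI0 x tau : 0 <= x%:E * KI x tau.
  have [x0|x0] := leP 0%R x; first by apply: mule_ge0.
  rewrite /KI preimage_nnfun0// /kernel_integrand big1 ?mule0// => e _.
  by rewrite integral0_eq ?mule0// => v _; rewrite indic0.
(* The middle term keeps the delay integral outside the sums: pointwise in [tau] it is bounded by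
   [c], and [induced_sts_le] on each level set puts it above the integral of [h]. *)
apply: (@le_trans _ _ (\int[delay_law H s]_(tau in delays H s)
    \sum_(x \in range h) x%:E * KI x tau)); last first.
  apply: (@le_trans _ _ (\int[delay_law H s]_(tau in delays H s) cst c%:E tau)).
    apply: ge0_le_integral.
    - exact: delays_measurable.
    - move=> tau _; rewrite fsbig_finite//=; apply: sume_ge0 => x _.
      exact: xKI0.
    - apply: emeasurable_fsum => // x.
      by apply: emeasurable_funM => //; exact: measurable_cst.
    - exact: measurable_cst.
    - move=> tau dtau; apply: kernel_integrand_nnsfun_le => // e eH es en.
      apply: le_trans (gc tau e eH es en); apply: ge0_le_integral => //.
      + by move=> v _; rewrite lee_fin.
      + by apply/measurable_EFinP; exact: (measurable_slice (tgt e) (g := h)).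
      + exact: measurable_slice.
  rewrite integral_cst; last exact: delays_measurable.
  by rewrite [X in _ * X]delay_law_delays mule1.
rewrite fsbig_finite//=.
rewrite [leRHS](eq_integral (fun tau =>
    \sum_(x <- finmap.enum_fset (fset_set (range h))) x%:E * KI x tau)); last first.
  by move=> tau _; rewrite fsbig_finite.
rewrite ge0_integral_sum//; first last.
- by move=> x; apply: emeasurable_funM => //; exact: measurable_cst.
- exact: delays_measurable.
apply: lee_sum => x _; have [x0|x0] := leP 0%R x.
  rewrite ge0_integralZl//; last exact: delays_measurable.
  by apply: lee_wpmul2l; [rewrite lee_fin|exact: induced_sts_le].
rewrite preimage_nnfun0// measure0 mule0.
by apply: integral_ge0 => tau _; exact: xKI0.
Qed.


Lemma switch_guard (s : St) e : enabled H s e -> guard H e s.2.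
Proof. by move=> [s' [_ _ []]]. Qed.

(** If [g] is not 0, its supremum [M] is positive, hence not attained; a bound of [g] strictly below
    [M] is then produced. *)
Lemma cycle_reset_maximum_principle (HH : cycle_reset H) (g : St -> \bar R) :
  measurable_fun setT g -> (forall s, 0 <= g s) -> (forall s, g s <= 1) ->
  (forall s, g s <= \int[T s]_t g t) ->
  (forall m, 0 < m -> (forall s, g s <= m) -> forall s, g s < m) ->
  forall s, g s = 0.
Proof.
move=> mg g0 g1 g_le g_lt s0.
pose M := ereal_sup (range g).
have gM s : g s <= M by apply: ereal_sup_ubound; exists s.
have M1 : M <= 1 by apply: ge_ereal_sup => _ [s _ <-].
have M0 : 0 <= M by exact: le_trans (g0 s0) (gM s0).
have Mfin : M \is a fin_num by rewrite ge0_fin_numE// (le_lt_trans M1)// ltry.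
apply/eqP; apply: contraT => gs0.
have Mgt0 : 0 < M by rewrite (lt_le_trans _ (gM s0))// lt_def gs0 g0.
have gltM : forall s, g s < M by exact: g_lt.
(* For a strongly reset edge, [c] is the mean of [g] after it, the same from the whole guard;
   otherwise 0 serves. *)
have strong e : exists c : R, [/\ (0 <= c)%R, c%:E < M &
    strongly_reset H e -> forall v, guard H e v ->
      \int[reset_law H e v]_w g ((tgt e, w) : St) <= c%:E].
  have [[Re [nu [_ _ nuE]]]|ne] := pselect (strongly_reset H e); last first.
    by exists 0%R.
  have mge := measurable_slice (tgt e) mg.
  have cfin : \int[nu]_w g ((tgt e, w) : St) \is a fin_num.
    rewrite ge0_fin_numE; last exact: integral_ge0.
    apply: (@le_lt_trans _ _ 1); last exact: ltry.
    by apply: integral_le_cst => //; exact: probability_setT.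
  exists (fine (\int[nu]_w g ((tgt e, w) : St))); split.
  - by apply: fine_ge0; exact: integral_ge0.
  - rewrite fineK// lt_neqAle; apply/andP; split; last first.
      by apply: integral_le_cst => //; exact: probability_setT.
    (* A mean equal to [M] would make [g] almost surely equal to [M], a value it never takes. *)
    apply/negP => /eqP cM.
    have : nu [set w | g ((tgt e, w) : St) = M] = 1.
      by apply: integral_eq_max => //; exact: probability_setT.
    rewrite (_ : [set _ | _] = set0) ?measure0; last first.
      by rewrite -subset0 => w /= gwM; have := gltM (tgt e, w); rewrite gwM ltxx.
    by move/eqP; rewrite eqe eq_sym oner_eq0.
  - move=> _ v ev; rewrite fineK//.
    have [_ nuv] := nuE v ev.
    by rewrite (eq_measure_integral nu)// => C mC _; exact: nuv.
have [c cP] := choice strong.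
pose cmax : R := \big[Num.max/0%R]_(e : edge L A) c e.
have cmax0 : (0 <= cmax)%R by exact: bigmax_ge_id.
have c_le e : (c e <= cmax)%R by exact: le_bigmax.
have cmaxM : cmax%:E < M.
  rewrite -(fineK Mfin) lte_fin; apply/bigmax_ltP; split.
    by rewrite -lte_fin fineK.
  by move=> e _; rewrite -lte_fin fineK//; have [] := cP e.
have bounded s : g s <= cmax%:E.
  rewrite leNgt; apply/negP => gs.
  (* The locations where the bound fails somewhere. *)
  pose P : pred L := fun l => `[< exists v : Rn R n, cmax%:E < g ((l, v) : St) >].
  apply: (@cycle_reset_acyclic HH P s.1); first by apply/asboolP; exists s.2; case: s gs.
  (* If no edge without strong reset led from [l] back into [P], the mean of [g] after every enabled
     edge would be at most [cmax], and so would [g (l, v)]. *)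
  move=> l /asboolP[v lv]; apply: contrapT => noedge.
  move: lv; apply/negP; rewrite -leNgt (le_trans (g_le _))//.
  apply: integral_induced_sts_le => // tau e eH es en.
  have [se|nse] := pselect (strongly_reset H e).
    apply: (@le_trans _ _ (c e)%:E); last by rewrite lee_fin.
    by have [_ _ ce] := cP e; apply: ce => //; exact: switch_guard en.
  apply: integral_le_cst => //; first exact: probability_setT.
    exact: measurable_slice.
  move=> w; rewrite leNgt; apply/negP => gw; apply: noedge; exists e; split=> //.
  by apply/asboolP; exists w.
have : M <= cmax%:E by apply: ge_ereal_sup => _ [s _ <-].
by rewrite leNgt cmaxM.
Qed.

End hybrid.

Theorem proposition3p9 (R : realType) (L : finPointedType) (A : finType)
    (n : nat) (H : stochastic_hybrid_system R L A n) (HH : cycle_reset H)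
    (B : set (state R L n)) (mB : measurable B) :
  decisive (induced_sts H) B.
Proof.
have mL := measurable_limbo (induced_sts H) mB.
apply: decisive_surv => //; apply: cycle_reset_maximum_principle HH _ _ _ _ _ _.
- exact: measurable_surv.
- exact: surv_ge0.
- exact: surv_le1.
(* Harmonicity on [limbo] and vanishing elsewhere give subharmonicity everywhere. *)
- move=> s; rewrite survE// -[leRHS]mul1e; apply: lee_wpmul2r.
    by apply: integral_ge0 => t _; exact: surv_ge0.
  by rewrite lee_fin indicE lern1 leq_b1.
- exact: surv_limbo_lt.
Qed.
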